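(* Let $(\mathcal{H}_1,\mathfrak{A}_0)$ and $(\mathcal{H}_2,\mathfrak{B}_0)$ be unital Hilbert quasi *-algebras, and let $(\mathcal{H}_1\widehat{\otimes}^h\mathcal{H}_2,\mathfrak{A}_0\otimes\mathfrak{B}_0)$ be their tensor product Hilbert quasi *-algebra. If $\omega_1$ and $\omega_2$ are representable and continuous functionals on $\mathcal{H}_1$ and $\mathcal{H}_2$ respectively, then the linear functional $\omega_1\otimes\omega_2$ on $\mathcal{H}_1\otimes\mathcal{H}_2$, defined by $$(\omega_1\otimes\omega_2)\Big(\sum_{i=1}^n\xi_i\otimes\eta_i\Big)=\sum_{i=1}^n\omega_1(\xi_i)\,\omega_2(\eta_i),$$ extends continuously to a representable and continuous functional on $\mathcal{H}_1\widehat{\otimes}^h\mathcal{H}_2$.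
   Context: All vector spaces are complex, and inner products are linear in the first variable. Quasi *-algebra: a pair $(\mathfrak{A},\mathfrak{A}_0)$ consisting of a vector space $\mathfrak{A}$ and a *-algebra $\mathfrak{A}_0$ contained in $\mathfrak{A}$ as a subspace such that (i) $\mathfrak{A}$ carries an involution $a\mapsto a^*$ extending that of $\mathfrak{A}_0$; (ii) $\mathfrak{A}$ is a bimodule over $\mathfrak{A}_0$ and the module multiplications extend the multiplication of $\mathfrak{A}_0$, in particular $(xa)y=x(ay)$ and $a(xy)=(ax)y$ for all $a\in\mathfrak{A}$, $x,y\in\mathfrak{A}_0$; (iii) $(ax)^*=x^*a^*$ for all $a\in\mathfrak{A}$, $x\in\mathfrak{A}_0$. It is unital if there is $\mathbb{1}\in\mathfrak{A}_0$ with $a\mathbb{1}=a=\mathbb{1}a$ for all $a\in\mathfrak{A}$. Hilbert quasi *-algebra: let $\mathfrak{A}_0$ be a *-algebra which is also a pre-Hilbert space with inner product $\langle\cdot|\cdot\rangle$ such that (1) for each $x\in\mathfrak{A}_0$ the map $y\in\mathfrak{A}_0\mapsto xy\in\mathfrak{A}_0$ is continuous for the norm defined by the inner product; (2) $\langle xy|z\rangle=\langle y|x^*z\rangle$ for all $x,y,z\in\mathfrak{A}_0$; (3) $\langle x|y\rangle=\langle y^*|x^*\rangle$ for all $x,y\in\mathfrak{A}_0$; (4) $\mathfrak{A}_0^2=\{xy:x,y\in\mathfrak{A}_0\}$ is total in $\mathfrak{A}_0$. If $\mathcal{H}$ is the Hilbert space completion of $\mathfrak{A}_0$, then $(\mathcal{H},\mathfrak{A}_0)$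 is called a Hilbert quasi *-algebra. The involution of $\mathfrak{A}_0$ and left and right multiplications by elements of $\mathfrak{A}_0$ are extended to $\mathcal{H}$ by continuity, making $(\mathcal{H},\mathfrak{A}_0)$ a quasi *-algebra. Tensor product Hilbert quasi *-algebra: for unital Hilbert quasi *-algebras $(\mathcal{H}_1,\mathfrak{A}_0)$, $(\mathcal{H}_2,\mathfrak{B}_0)$ with inner products $\langle\cdot|\cdot\rangle_1,\langle\cdot|\cdot\rangle_2$, the algebraic tensor product $\mathfrak{A}_0\otimes\mathfrak{B}_0$ is a *-algebra with $(x\otimes y)(x'\otimes y')=xx'\otimes yy'$ and $(x\otimes y)^*=x^*\otimes y^*$ (extended linearly, resp. conjugate-linearly). $\mathcal{H}_1\widehat{\otimes}^h\mathcal{H}_2$ is the completion of the algebraic tensor product $\mathcal{H}_1\otimes\mathcal{H}_2$ (equivalently, of its dense subspace $\mathfrak{A}_0\otimes\mathfrak{B}_0$) with respect to the inner product $\langle\sum_i\xi_i\otimes\eta_i|\sum_j\xi'_j\otimes\eta'_j\rangle=\sum_{i,j}\langle\xi_i|\xi'_j\rangle_1\langle\eta_i|\eta'_j\rangle_2$. The pair $(\mathcal{H}_1\widehat{\otimes}^h\mathcal{H}_2,\mathfrak{A}_0\otimes\mathfrak{B}_0)$ is a unital Hilbert quasi *-algebra, called the tensor product Hilbert quasi *-algebra. Representable functionals: a linear functional $\omega:\mathfrak{A}\to\mathbb{C}$ on a quasi *-algebra $(\mathfrak{A},\mathfrak{A}_0)$ is representable if (L.1) $\omega(x^*x)\ge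 0$ for all $x\in\mathfrak{A}_0$; (L.2) $\omega(y^*a^*x)=\overline{\omega(x^*ay)}$ for all $x,y\in\mathfrak{A}_0$, $a\in\mathfrak{A}$; (L.3) for every $a\in\mathfrak{A}$ there is $\gamma_a>0$ with $|\omega(a^*x)|\le\gamma_a\,\omega(x^*x)^{1/2}$ for all $x\in\mathfrak{A}_0$. Representability on $\mathcal{H}_1$, $\mathcal{H}_2$, $\mathcal{H}_1\widehat{\otimes}^h\mathcal{H}_2$ is understood with respect to the *-algebras $\mathfrak{A}_0$, $\mathfrak{B}_0$, $\mathfrak{A}_0\otimes\mathfrak{B}_0$ respectively, and continuity with respect to the Hilbert space norms. *)

(* Defs.v *)
From HB Require Import structures.
From mathcomp Require Import all_boot all_order all_algebra.
From mathcomp Require Import complex.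
From mathcomp Require Import all_classical all_reals all_analysis.

Set Implicit Arguments.
Unset Strict Implicit.
Unset Printing Implicit Defensive.

Import Order.TTheory GRing.Theory Num.Theory.
Import numFieldNormedType.Exports.
Local Open Scope classical_set_scope.
Local Open Scope ring_scope.

(* The norm of a normedModType over R[i] takes its values in R[i] (as         *)
(* nonnegative reals); inner_norm says it is the one given by the inner       *)
(* product. {dot V for Num.conj} is linear in the first variable.             *)
HB.mixin Record NormedModule_isPreHilbert (R : realType) V
    of NormedModule R[i] V := {
  inner : {dot V for @Num.conj R[i]} ;
  inner_norm : forall x : V, `|x| ^+ 2 = inner x x
}.

#[short(type="preHilbertType")]
HB.structure Definition PreHilbert (R : realType) :=
  {V of NormedModule_isPreHilbert R V & NormedModule R[i] V}.

#[short(type="hilbertType")]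
HB.structure Definition Hilbert (R : realType) :=
  {V of PreHilbert R V & CompleteNormedModule R[i] V}.

(* A complex *-algebra, not required to have a unit (nor to be nonzero),      *)
(* hence not an algType.                                                      *)
HB.mixin Record Lmodule_isStarAlgebra (R : realType) V
    of GRing.Lmodule R[i] V := {
  smul : {bilinear V -> V -> V} ;
  star : {linear V -> V | @Num.conj R[i] \; *:%R} ;
  smulA : forall x y z : V, smul x (smul y z) = smul (smul x y) z ;
  starK : involutive star ;
  starM : forall x y : V, star (smul x y) = smul (star y) (star x)
}.

#[short(type="starAlgType")]
HB.structure Definition StarAlgebra (R : realType) :=
  {V of Lmodule_isStarAlgebra R V & GRing.Lmodule R[i] V}.

#[short(type="preHilbertStarAlgType")]
HB.structure Definition PreHilbertStarAlgebra (R : realType) :=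
  {V of StarAlgebra R V & PreHilbert R V}.

(* The pair (A, A0): A0 is a type of its own, sitting in A through the        *)
(* injection qincl; qlmul x a and qrmul a x are the module products           *)
(* x a and a x.                                                               *)
Record quasi_star_algebra (R : realType) (A0 : starAlgType R)
    (A : lmodType R[i]) := QuasiStarAlgebra {
  qincl : {linear A0 -> A} ;
  qinv : {linear A -> A | @Num.conj R[i] \; *:%R} ;
  qlmul : {bilinear A0 -> A -> A} ;
  qrmul : {bilinear A -> A0 -> A} ;
  qincl_inj : injective qincl ;
  qinvK : involutive qinv ;
  qinv_incl : forall x, qinv (qincl x) = qincl (star x) ;
  qlmul_incl : forall x y, qlmul x (qincl y) = qincl (smul x y) ;
  qrmul_incl : forall x y, qrmul (qincl x) y = qincl (smul x y) ;
  qlmulA : forall x y a, qlmul (smul x y) a = qlmul x (qlmul y a) ;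
  qrmulA : forall a x y, qrmul a (smul x y) = qrmul (qrmul a x) y ;
  qlrmulA : forall x a y, qrmul (qlmul x a) y = qlmul x (qrmul a y) ;
  qinvM : forall a x, qinv (qrmul a x) = qlmul (star x) (qinv a)
}.

Section QuasiStarAlgebraTheory.
Variables (R : realType) (A0 : starAlgType R) (A : lmodType R[i]).
Variable Q : quasi_star_algebra A0 A.

Definition unital :=
  exists e : A0, forall a : A, qrmul Q a e = a /\ qlmul Q e a = a.

(* On R[i], 0 <= z means that z is real and nonnegative; sqrtC z is then the  *)
(* nonnegative square root of z. In L3, gamma is a positive real.             *)
Record representable (w : {scalar A}) : Prop := Representable {
  repL1 : forall x : A0, 0 <= w (qincl Q (smul (star x) x)) ;
  repL2 : forall (x y : A0) (a : A),
    w (qlmul Q (star y) (qrmul Q (qinv Q a) x)) =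
    Num.conj (w (qlmul Q (star x) (qrmul Q a y))) ;
  repL3 : forall a : A, exists2 gamma : R[i], 0 < gamma &
    forall x : A0, `|w (qrmul Q (qinv Q a) x)| <=
      gamma * sqrtC (w (qincl Q (smul (star x) x)))
}.

End QuasiStarAlgebraTheory.

Definition linear_span (K : nzRingType) (V : lmodType K) (S : set V) : set V :=
  [set v | exists (n : nat) (c : 'I_n -> K) (s : 'I_n -> V),
     (forall i, S (s i)) /\ v = \sum_(i < n) c i *: s i].

Definition is_completion (R : realType) (V : preHilbertType R)
    (H : hilbertType R) (i : {linear V -> H}) : Prop :=
  (forall x y : V, inner (i x) (i y) = inner x y) /\ dense (range i).

(* That the involution and the multiplications of H are the extensions by     *)
(* continuity of those of A0 is expressed by the last three fields: the       *)
(* underlying quasi *-algebra structure extends the operations of A0, and     *)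
(* A0 is dense in H, so continuity determines them.                           *)
Record hilbert_quasi_star_algebra (R : realType)
    (A0 : preHilbertStarAlgType R) (H : hilbertType R) :=
    HilbertQuasiStarAlgebra {
  hquasi :> quasi_star_algebra A0 H ;
  hmul_continuous : forall x : A0, continuous (smul x : A0 -> A0) ;
  hinner_mul : forall x y z : A0,
    inner (smul x y) z = inner y (smul (star x) z) ;
  hinner_star : forall x y : A0, inner x y = inner (star y) (star x) ;
  hmul_total : dense (linear_span [set z : A0 | exists x y, z = smul x y]) ;
  hcompletion : is_completion (qincl hquasi) ;
  hinv_continuous : continuous (qinv hquasi : H -> H) ;
  hlmul_continuous : forall x : A0, continuous (qlmul hquasi x : H -> H) ;
  hrmul_continuous : forall x : A0,
    continuous ((fun a => qrmul hquasi a x) : H -> H)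
}.

Definition is_tensor_product (K : comNzRingType) (U V T : lmodType K)
    (t : {bilinear U -> V -> T}) : Prop :=
  forall (W : lmodType K) (f : {bilinear U -> V -> W}),
    (exists g : {linear T -> W}, forall u v, g (t u v) = f u v) /\
    (forall g h : {linear T -> W},
       (forall u v, g (t u v) = h (t u v)) -> g =1 h).

(* (K, T0) is the tensor product of (H1, A0) and (H2, B0): T0 is the          *)
(* *-algebra A0 (x) B0, H12 is H1 (x) H2 with its inner product, whose        *)
(* formula on sums follows from thinner by sesquilinearity, K is the          *)
(* completion of H12, and thcompat identifies A0 (x) B0 with a subspace       *)
(* of H1 (x) H2 inside K.                                                     *)
Record tensor_product_hilbert_quasi_star_algebra (R : realType)
    (A0 B0 T0 : preHilbertStarAlgType R) (H1 H2 K : hilbertType R)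
    (H12 : preHilbertType R)
    (Q1 : hilbert_quasi_star_algebra A0 H1)
    (Q2 : hilbert_quasi_star_algebra B0 H2)
    (Q : hilbert_quasi_star_algebra T0 K) :=
    TensorProductHilbertQuasiStarAlgebra {
  tens0 : {bilinear A0 -> B0 -> T0} ;
  tens0P : is_tensor_product tens0 ;
  tens0M : forall x y x' y',
    smul (tens0 x y) (tens0 x' y') = tens0 (smul x x') (smul y y') ;
  tens0_star : forall x y, star (tens0 x y) = tens0 (star x) (star y) ;
  tensh : {bilinear H1 -> H2 -> H12} ;
  tenshP : is_tensor_product tensh ;
  thinner : forall xi eta xi' eta',
    inner (tensh xi eta) (tensh xi' eta') = inner xi xi' * inner eta eta' ;
  thincl : {linear H12 -> K} ;
  thcompletion : is_completion thincl ;
  thcompat : forall x y,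
    qincl Q (tens0 x y) = thincl (tensh (qincl Q1 x) (qincl Q2 y))
}.

(* Main.v *)
Require Import Defs.
From HB Require Import structures.
From mathcomp Require Import all_boot all_order all_algebra.
From mathcomp Require Import complex ring lra.
From mathcomp Require Import all_classical all_reals all_analysis.
Import Order.TTheory GRing.Theory Num.Theory.
Import numFieldNormedType.Exports.
Local Open Scope classical_set_scope.
Local Open Scope ring_scope.

(** The functional w1 (x) w2 is defined on H1 (x) H2 by the universal property,
    and has to be shown bounded there and, after its extension w to the
    completion, representable. Both facts are instances of one principle: the
    tensor product of two bounded sesquilinear pairings is bounded
    (tensor_CauchySchwarz). If |s x y|^2 <= p x x * q y y for positive forms p
    and q, then p, s, s^*, q are the blocks of a positive form on the direct sum
    of the two spaces. Tensor products of positive forms are positive, which is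
    the Schur product theorem (schur_product), and reading off the blocks of the
    product gives the bound for s1 (x) s2. Elements of algebraic tensor products
    are finite sums of elementary tensors (tensor_product_sum), so these
    statements about finite families are all that is needed.

    Applied to the functionals themselves, seen as pairings with the complex
    numbers, the principle gives |w1 (x) w2 (z)| <= M1 M2 |z|, and the
    functional extends to the completion (bounded_extension).

    For representability one looks at the GNS form (x, y) |-> w (y^* x) on the
    *-algebra. The condition (L.3) for w1 provides a constant for each element a
    separately, which says nothing about sums of elementary tensors. By the
    uniform boundedness principle the constant can be taken proportional to the
    norm of a (representable_uniform): |w1 (a^* x)|^2 <= M |a|^2 w1 (x^* x).
    This is a bound of the GNS pairing by the GNS form and the inner product,
    and the principle transfers it, with the product of the two constants, to w
    on A0 (x) B0. Positivity (L.1) of w on A0 (x) B0 is the Schur product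
    theorem again. Symmetry (L.2) on A0 (x) B0 is automatic for a positive form,
    and (L.2) and (L.3) pass to all elements of the completion by density and
    continuity (representable_of_gns_bound). *)

Set Implicit Arguments.
Unset Strict Implicit.
Unset Printing Implicit Defensive.

(** * Positive sesquilinear forms *)

Section PositiveForms.
Variable C : numClosedFieldType.
Implicit Types U V : lmodType C.

Definition sesquilinear U V (s : U -> V -> C) :=
  (forall a x x' y, s (a *: x + x') y = a * s x y + s x' y) /\
  (forall a x y y', s x (a *: y + y') = a^* * s x y + s x y').

Definition positive_form U (p : U -> U -> C) :=
  sesquilinear p /\ forall x, 0 <= p x x.

Lemma sesquilinear_suml U V (s : U -> V -> C) (I : finType) (c : I -> C)
    (x : I -> U) (y : V) :
  sesquilinear s -> s (\sum_i c i *: x i) y = \sum_i c i * s (x i) y.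
Proof.
move=> [sl _]; elim/big_rec2: _ => [|i u v _ <-]; last by rewrite sl.
by have := sl (-1) 0 0 y; rewrite scaler0 addr0 mulN1r addNr.
Qed.

Lemma sesquilinear_sumr U V (s : U -> V -> C) (I : finType) (d : I -> C)
    (x : U) (y : I -> V) :
  sesquilinear s -> s x (\sum_i d i *: y i) = \sum_i (d i)^* * s x (y i).
Proof.
move=> [_ sr]; elim/big_rec2: _ => [|i u v _ <-]; last by rewrite sr.
by have := sr (-1) x 0 0; rewrite scaler0 addr0 rmorphN1 mulN1r addNr.
Qed.

Lemma sesquilinear0l U V (s : U -> V -> C) y : sesquilinear s -> s 0 y = 0.
Proof.
by move=> [sl _]; have := sl (-1) 0 0 y; rewrite scaler0 addr0 mulN1r addNr.
Qed.

Lemma sesquilinear0r U V (s : U -> V -> C) x : sesquilinear s -> s x 0 = 0.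
Proof.
move=> [_ sr]; have := sr (-1) x 0 0.
by rewrite scaler0 addr0 rmorphN1 mulN1r addNr.
Qed.

Lemma sesquilinearZ U V (s : U -> V -> C) a b x y :
  sesquilinear s -> s (a *: x) (b *: y) = a * b^* * s x y.
Proof.
move=> ss; rewrite -[a *: x]addr0 -[b *: y]addr0 ss.1 !ss.2.
by rewrite !(sesquilinear0l _ ss) (sesquilinear0r _ ss); ring.
Qed.

(** The quadratic form in l and m has diagonal P, Q and off-diagonal s, so its
    positivity gives a nonnegative determinant. The weights (Q, -s) exhibit it
    multiplied by Q, the weights (-s^*, P) exhibit it multiplied by P, and
    (1, -s) shows that s vanishes if both P and Q do. *)
Lemma norm_le_quadratic (P Q s : C) : 0 <= P -> 0 <= Q ->
  (forall l m, 0 <= l * l^* * P + m * m^* * Q + l * m^* * s + (l * m^* * s)^*) ->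
  `|s| ^+ 2 <= P * Q.
Proof.
move=> P0 Q0 pos.
have PR : P^* = P by apply/CrealP/ger0_real.
have QR : Q^* = Q by apply/CrealP/ger0_real.
rewrite normCK; have [Qz|Qn0] := eqVneq Q 0; last first.
  have := pos Q (- s).
  rewrite !rmorphM !rmorphN /= QR conjCK.
  have -> : Q * Q * P + - s * - s^* * Q + Q * - s^* * s + Q * - s * s^*
    = Q * (P * Q - s * s^*) by ring.
  by rewrite pmulr_rge0 ?subr_ge0// lt_def Qn0.
have [Pz|Pn0] := eqVneq P 0; last first.
  have := pos (- s^*) P.
  rewrite !rmorphM !rmorphN /= !PR conjCK.
  have -> : - s^* * - s * P + P * P * Q + - s^* * P * s + - s * P * s^*
    = P * (P * Q - s * s^*) by ring.
  by rewrite pmulr_rge0 ?subr_ge0// lt_def Pn0.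
have := pos 1 (- s).
rewrite Pz Qz !rmorphM !rmorphN !rmorph1 /= conjCK.
have -> : 1 * 1 * 0 + - s * - s^* * 0 + 1 * - s^* * s + 1 * - s * s^*
   = - 2 * (s * s^*) by ring.
by rewrite mulNr oppr_ge0 pmulr_rle0 // mul0r.
Qed.

(** Polarization: p (c x + y) (c x + y) is real for c = 1 and for c = 'i, and
    these two facts determine the real and imaginary parts. *)
Lemma positive_form_herm U (p : U -> U -> C) x y :
  positive_form p -> p y x = (p x y)^*.
Proof.
move=> [[pl pr] p0].
have expand c : p (c *: x + y) (c *: x + y) =
    c * c^* * p x x + p y y + (c * p x y + c^* * p y x).
  by rewrite pl !pr; ring.
have real c : (c * p x y + c^* * p y x)^* = c * p x y + c^* * p y x.
  apply/CrealP.
  have -> : c * p x y + c^* * p y x =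
      p (c *: x + y) (c *: x + y) - (c * c^* * p x x + p y y).
    by rewrite expand; ring.
  by rewrite realB// ger0_real// addr_ge0// mulr_ge0// mul_conjC_ge0.
have := real 1; have := real 'i.
rewrite !rmorphD !rmorphM !rmorph1 /= !conjCi !rmorphN /= conjCi opprK !mul1r.
set s := p x y; set t := p y x => Ei E1.
have {}Ei : s^* - t^* = t - s.
  apply: (@mulfI _ 'i); first exact: neq0Ci.
  apply: (@oppr_inj _).
  transitivity (- 'i * s^* + 'i * t^*); first by ring.
  by rewrite Ei; ring.
apply: (@mulfI _ 2); first by rewrite pnatr_eq0.
transitivity ((s + t) + (t - s)); first by ring.
by rewrite -E1 -Ei; ring.
Qed.

Lemma positive_form_CauchySchwarz U (p : U -> U -> C) x y :
  positive_form p -> `|p x y| ^+ 2 <= p x x * p y y.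
Proof.
move=> pp; have [[pl pr] p0] := pp.
apply: norm_le_quadratic => // l m.
(* the trailing 0 puts m *: y in the shape that the additivity rules rewrite *)
suff -> : l * l^* * p x x + m * m^* * p y y + l * m^* * p x y +
    (l * m^* * p x y)^* = p (l *: x + (m *: y + 0)) (l *: x + (m *: y + 0)) by [].
rewrite !pl !pr !(sesquilinear0l _ pp.1) !(sesquilinear0r _ pp.1).
by rewrite (positive_form_herm x y pp) !rmorphM /= conjCK; ring.
Qed.

(** This is positivity of the tensor product of two positive forms, on the
    element sum_i x_i (x) y_i; in terms of Gram matrices it is the Schur product
    theorem. Removing from every x_i its p1-component along x_0 splits the sum
    into the sum for a family with one member less and a rank one part
    p2 z z / p1 x_0 x_0 for z = sum_i p1 x_i x_0 *: y_i. *)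
Lemma schur_product U1 U2 (p1 : U1 -> U1 -> C) (p2 : U2 -> U2 -> C)
    n (x : 'I_n -> U1) (y : 'I_n -> U2) :
  positive_form p1 -> positive_form p2 ->
  0 <= \sum_i \sum_j p1 (x i) (x j) * p2 (y i) (y j).
Proof.
move=> pp1 pp2; elim: n => [|n IHn] in x y *; first by rewrite big_ord0.
have [s1 p1_ge0] := pp1; have [p1l p1r] := s1; have [s2 p2_ge0] := pp2.
pose x0 := x ord0; pose a := p1 x0 x0.
have aR : a^* = a by apply/CrealP/ger0_real/p1_ge0.
(* when a = 0 the inverse is 0, x' = x, and x_0 is p1-orthogonal to everything *)
pose x' i := - (a^-1 * p1 (x i) x0) *: x0 + x i.
have x'0 z : p1 (x' ord0) z = 0.
  rewrite p1l -/x0 -/a; have [a0|an0] := eqVneq a 0; last first.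
    by rewrite mulVf// mulN1r addNr.
  have := positive_form_CauchySchwarz x0 z pp1.
  rewrite -/a a0 mul0r mulr0 oppr0 mul0r add0r => le0.
  apply/eqP; rewrite -normr_eq0 -sqrf_eq0 eq_le le0.
  by rewrite exprn_ge0.
have x'0r z : p1 z (x' ord0) = 0.
  by rewrite (positive_form_herm (x' ord0) z pp1) x'0 rmorph0.
have p1E i j : p1 (x i) (x j) =
    p1 (x' i) (x' j) + a^-1 * p1 (x i) x0 * (p1 (x j) x0)^*.
  rewrite p1l !p1r -/x0 -/a !rmorphN !rmorphM /= fmorphV /= aR.
  rewrite (positive_form_herm (x j) x0 pp1).
  have [->|an0] := eqVneq a 0; first by rewrite invr0; ring.
  by field.
pose z := \sum_i p1 (x i) x0 *: y i.
have -> : \sum_i \sum_j p1 (x i) (x j) * p2 (y i) (y j) =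
    \sum_i \sum_j p1 (x' i) (x' j) * p2 (y i) (y j) + a^-1 * p2 z z.
  rewrite (sesquilinear_suml _ _ _ s2) mulr_sumr -big_split.
  apply: eq_bigr => i _ /=.
  rewrite (sesquilinear_sumr _ _ _ s2) !mulr_sumr -big_split.
  by apply: eq_bigr => j _ /=; rewrite p1E; ring.
apply: addr_ge0; last by rewrite mulr_ge0 ?invr_ge0// p1_ge0.
rewrite big_ord_recl big1 ?add0r => [|j _]; last by rewrite x'0 mul0r.
rewrite (eq_bigr (fun i => \sum_j p1 (x' (lift ord0 i)) (x' (lift ord0 j))
   * p2 (y (lift ord0 i)) (y (lift ord0 j)))) ?IHn// => i _.
by rewrite big_ord_recl x'0r mul0r add0r.
Qed.

Lemma positive_formZ U (p : U -> U -> C) (k : C) :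
  0 <= k -> positive_form p -> positive_form (fun x y => k * p x y).
Proof.
move=> k0 [[pl pr] p0]; split; last by move=> x; rewrite mulr_ge0.
by split=> *; rewrite ?pl ?pr; ring.
Qed.

Definition dominated U V (s : U -> V -> C) (p : U -> U -> C) (q : V -> V -> C) :=
  [/\ sesquilinear s, positive_form p, positive_form q &
      forall x y, `|s x y| ^+ 2 <= p x x * q y y].

(** The form on U * V with the block matrix [p, s; s^*, q]. *)
Definition block_form U V (s : U -> V -> C) (p : U -> U -> C) (q : V -> V -> C)
    (z z' : (U * V)%type) : C :=
  p z.1 z'.1 + q z.2 z'.2 + (s z.1 z'.2 + (s z'.1 z.2)^*).

(** The cross terms amount to 2 Re (s x y), which is at most 2 sqrt (p x x) sqrt
    (q y y), hence at most p x x + q y y. *)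
Lemma block_form_positive U V (s : U -> V -> C) p q :
  dominated s p q -> positive_form (block_form s p q).
Proof.
move=> [[sl sr] [[pl pr] p0] [[ql qr] q0] le_s]; split; first split.
- move=> a [x y] [x1 y1] [x2 y2]; rewrite /block_form /= pl ql sl sr.
  by rewrite rmorphD rmorphM /= conjCK; ring.
- move=> a [x y] [x1 y1] [x2 y2]; rewrite /block_form /= pr qr sr sl.
  by rewrite rmorphD rmorphM /=; ring.
move=> [x y]; rewrite /block_form /=.
have le2 : `|s x y + (s x y)^*| <= p x x + q y y.
  apply: le_trans (ler_normD _ _) _; rewrite norm_conjC.
  rewrite -ler_sqr ?nnegrE ?addr_ge0//.
  apply: le_trans (_ : 4 * (p x x * q y y) <= _).
    have -> : (`|s x y| + `|s x y|) ^+ 2 = 4 * `|s x y| ^+ 2 by ring.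
    by rewrite ler_pM2l.
  rewrite -subr_ge0.
  have -> : (p x x + q y y) ^+ 2 - 4 * (p x x * q y y) = (p x x - q y y) ^+ 2.
    by ring.
  by rewrite real_exprn_even_ge0// realB// ger0_real.
have sR : s x y + (s x y)^* \is Num.real.
  by apply/CrealP; rewrite rmorphD /= conjCK addrC.
by have := real_lerNnormlW sR le2; rewrite -subr_ge0 opprK addrC.
Qed.

(** Bounded pairings have bounded tensor products. A Cauchy-Schwarz bound for s
    is the same as positivity of the block form of p, s and q, and positivity
    passes to tensor products. The two families are put together into one family
    in U * V; all the mixed terms other than s1 * s2 and its conjugate vanish,
    and the weights l and r recover the product bound. *)
Lemma tensor_CauchySchwarz U1 V1 U2 V2
    (s1 : U1 -> V1 -> C) p1 q1 (s2 : U2 -> V2 -> C) p2 q2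
    m n (x1 : 'I_m -> U1) (x2 : 'I_m -> U2) (y1 : 'I_n -> V1) (y2 : 'I_n -> V2) :
  dominated s1 p1 q1 -> dominated s2 p2 q2 ->
  `|\sum_i \sum_j s1 (x1 i) (y1 j) * s2 (x2 i) (y2 j)| ^+ 2 <=
  (\sum_i \sum_j p1 (x1 i) (x1 j) * p2 (x2 i) (x2 j)) *
  (\sum_i \sum_j q1 (y1 i) (y1 j) * q2 (y2 i) (y2 j)).
Proof.
move=> d1 d2.
have [ss1 pp1 pq1 _] := d1; have [ss2 pp2 pq2 _] := d2.
have [[sp1 _] [sq1 _]] := (pp1, pq1); have [[sp2 _] [sq2 _]] := (pp2, pq2).
apply: norm_le_quadratic; try exact: schur_product.
move=> l r.
(* both families, placed on the two axes of U * V and weighted by l and r *)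
pose z1 (k : 'I_(m + n)) : (U1 * V1)%type := match fintype.split k with
  inl i => (l *: x1 i, 0) | inr j => (0, r *: y1 j) end.
pose z2 (k : 'I_(m + n)) : (U2 * V2)%type := match fintype.split k with
  inl i => (x2 i, 0) | inr j => (0, y2 j) end.
have := schur_product z1 z2 (block_form_positive d1) (block_form_positive d2).
have z1l i : z1 (lshift n i) = (l *: x1 i, 0) by rewrite /z1 (unsplitK (inl i)).
have z1r j : z1 (rshift m j) = (0, r *: y1 j) by rewrite /z1 (unsplitK (inr j)).
have z2l i : z2 (lshift n i) = (x2 i, 0) by rewrite /z2 (unsplitK (inl i)).
have z2r j : z2 (rshift m j) = (0, y2 j) by rewrite /z2 (unsplitK (inr j)).
congr (0 <= _); rewrite big_split_ord /=.
under eq_bigr => i _.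
  rewrite big_split_ord /=.
  under eq_bigr => j _.
    rewrite !z1l !z2l /block_form /= (sesquilinearZ _ _ _ _ sp1).
    rewrite !(sesquilinear0l _ sq1) !(sesquilinear0l _ sq2).
    rewrite !(sesquilinear0r _ ss1) !(sesquilinear0r _ ss2).
    rewrite !rmorph0 !addr0 -(mulrA (_ * _) (p1 _ _)); over.
  under [X in _ + X]eq_bigr => j _.
    rewrite !z1l !z2l !z1r !z2r /block_form /= (sesquilinearZ _ _ _ _ ss1).
    rewrite !(sesquilinear0l _ sq1) !(sesquilinear0l _ sq2).
    rewrite !(sesquilinear0r _ sp1) !(sesquilinear0r _ sp2).
    rewrite !(sesquilinear0r _ ss1) !(sesquilinear0r _ ss2).
    rewrite !rmorph0 !addr0 !add0r -(mulrA (_ * _) (s1 _ _)); over.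
  rewrite -!mulr_sumr; over.
under [X in _ + X]eq_bigr => i _.
  rewrite big_split_ord /=.
  under eq_bigr => j _.
    rewrite !z1l !z2l !z1r !z2r /block_form /= (sesquilinearZ _ _ _ _ ss1).
    rewrite !(sesquilinear0r _ sq1) !(sesquilinear0r _ sq2).
    rewrite !(sesquilinear0l _ sp1) !(sesquilinear0l _ sp2).
    rewrite !(sesquilinear0l _ ss1) !(sesquilinear0l _ ss2).
    rewrite !addr0 !add0r -!rmorphM -(mulrA (_ * _) (s1 _ _)); over.
  under [X in _ + X]eq_bigr => j _.
    rewrite !z1r !z2r /block_form /= (sesquilinearZ _ _ _ _ sq1).
    rewrite !(sesquilinear0l _ sp1) !(sesquilinear0l _ sp2).
    rewrite !(sesquilinear0l _ ss1) !(sesquilinear0l _ ss2).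
    rewrite !rmorph0 !addr0 !add0r -(mulrA (_ * _) (q1 _ _)); over.
  rewrite -!rmorph_sum -!mulr_sumr; over.
rewrite !big_split /= -!rmorph_sum -!mulr_sumr.
rewrite [X in _ + (Num.conj (_ * X) + _)]exchange_big /=.
rewrite -!addrA; congr (_ + _); rewrite [RHS]addrCA.
by congr (_ + _); exact: addrC.
Qed.

End PositiveForms.

(** * Elements of a tensor product as finite sums *)

Section TensorSums.
Variables (K : comNzRingType) (U V T : lmodType K) (t : {bilinear U -> V -> T}).

Definition tensor_sums : {pred T} := fun z =>
  `[< exists n (u : 'I_n -> U) (v : 'I_n -> V), z = \sum_i t (u i) (v i) >].

Lemma tensor_sumsP z : reflect
  (exists n (u : 'I_n -> U) (v : 'I_n -> V), z = \sum_i t (u i) (v i))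
  (z \in tensor_sums).
Proof. exact: asboolP. Qed.

Lemma tensor_sums_submod : submod_closed tensor_sums.
Proof.
split.
  by apply/tensor_sumsP; exists 0, (fun=> 0), (fun=> 0); rewrite big_ord0.
move=> a _ _ /tensor_sumsP[m [u [v ->]]] /tensor_sumsP[n [u' [v' ->]]].
apply/tensor_sumsP; exists (m + n)%N.
exists (fun k => match fintype.split k with
  inl i => a *: u i | inr j => u' j end).
exists (fun k => match fintype.split k with
  inl i => v i | inr j => v' j end).
rewrite big_split_ord /= scaler_sumr; congr (_ + _); apply: eq_bigr => k _.
  by rewrite (unsplitK (inl k)) linearZl_LR.
by rewrite (unsplitK (inr k)).
Qed.

HB.instance Definition _ :=
  GRing.isSubmodClosed.Build K T tensor_sums tensor_sums_submod.

(** The submodule of finite sums of elementary tensors is made a module in its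
    own right, because the universal property has to be applied with it as the
    target. *)
Record tensor_sum := TensorSum {
  tensor_sum_val :> T ; _ : tensor_sum_val \in tensor_sums }.
HB.instance Definition _ := [isSub for tensor_sum_val].
HB.instance Definition _ := [Choice of tensor_sum by <:].
HB.instance Definition _ := [SubChoice_isSubLmodule of tensor_sum by <:].

Lemma tensor_mem u v : t u v \in tensor_sums.
Proof.
by apply/tensor_sumsP; exists 1%N, (fun=> u), (fun=> v); rewrite big_ord1.
Qed.

Definition tensor_corestr u v : tensor_sum := TensorSum (tensor_mem u v).

Lemma tensor_corestr_bilinear : bilinear_for
  (GRing.Scale.Law.clone _ _ *:%R _) (GRing.Scale.Law.clone _ _ *:%R _)
  tensor_corestr.
Proof.
split=> [v|u] a x y; apply: val_inj => /=.
  by rewrite linearPl.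
by rewrite linearPr.
Qed.

HB.instance Definition _ := bilinear_isBilinear.Build K U V tensor_sum _ _
  tensor_corestr tensor_corestr_bilinear.

(** The universal property gives a linear retraction g of T onto the finite
    sums; followed by the inclusion it fixes the elementary tensors, so by
    uniqueness it is the identity. *)
Lemma tensor_product_sum (z : T) : is_tensor_product t ->
  exists n (u : 'I_n -> U) (v : 'I_n -> V), z = \sum_i t (u i) (v i).
Proof.
move=> tP; have [[g gt] _] := tP tensor_sum tensor_corestr.
have [_ uniq] := tP T t.
have gE : val (g z) = z.
  have valP u v : (val \o g) (t u v) = t u v by rewrite /= gt.
  exact: (uniq (val \o g) idfun).
by apply/tensor_sumsP; rewrite -gE; exact: (valP (g z)).
Qed.
End TensorSums.

(** * Uniform boundedness over the complex numbers *)

Lemma complex_archimedean (R : realType) (M : R[i]) :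
  M \is Num.real -> exists n : nat, M < n%:R.
Proof.
move=> /complex_realP[x ->]; exists (Num.truncn x).+1.
by rewrite -(rmorph_nat (real_complex R)) /= ltcR truncnS_gt.
Qed.

Lemma complex_small_inv (R : realType) (e : R[i]) :
  0 < e -> exists n : nat, n.+1%:R^-1 < e.
Proof.
move=> e0; have eVR : e^-1 \is Num.real by rewrite gtr0_real// invr_gt0.
have [n ltn] := complex_archimedean eVR.
exists n; rewrite -[e]invrK ltf_pV2 ?posrE ?invr_gt0//.
by rewrite (lt_le_trans ltn)// ler_nat.
Qed.

Lemma continuous_linear_bound (R : realType) (V W : normedModType R[i])
    (f : {linear V -> W}) :
  continuous f -> exists2 M : R[i], 0 < M & forall x, `|f x| <= M * `|x|.
Proof.
move=> /linear_bounded_continuous/linear_boundedP fM.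
near +oo_(R[i]) => M; exists M; first by near: M; exact: nbhs_pinfty_gt.
by near: M.
Unshelve. all: by end_near. Qed.

Section ContinuousFunctionals.
Variables (R : realType) (V : normedModType R[i]) (f : {scalar V}).

Let f_linear : linear (f : V -> R[i]^o).
Proof. by move=> c x y; rewrite linearP. Qed.

Let f_regular : {linear V -> R[i]^o} := HB.pack (f : V -> R[i]^o)
  (GRing.isLinear.Build _ _ _ _ (f : V -> R[i]^o) f_linear).

Lemma continuous_functional_bound : continuous (f : V -> R[i]^o) ->
  exists2 M : R[i], 0 < M & forall x, `|f x| <= M * `|x|.
Proof. exact: (@continuous_linear_bound R V R[i]^o f_regular). Qed.

Lemma bounded_functional_continuous (M : R[i]) :
  0 <= M -> (forall x, `|f x| <= M * `|x|) -> continuous (f : V -> R[i]^o).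
Proof.
move=> M0 fM; apply: (@bounded_linear_continuous R[i] V R[i]^o f_regular).
apply/linear_boundedP; near=> L => x; apply: le_trans (fM x) _.
by rewrite ler_wpM2r//; near: L; apply: nbhs_pinfty_ge; rewrite ger0_real.
Unshelve. all: by end_near. Qed.

End ContinuousFunctionals.

Section UniformBoundedness.
Variables (R : realType) (V : completeNormedModType R[i]).
Variables (W : normedModType R[i]) (I : Type) (T : I -> {linear V -> W}).
Hypothesis Tcont : forall i, continuous (T i).

(** A family that is bounded by a constant on some ball is, by translation to
    the origin and scaling, uniformly bounded. So an unbounded family has a
    member that is large at some point of any given ball, and it remains large
    on a smaller ball around that point, where its operator norm controls the
    variation. *)
Lemma unbounded_shrink (n : nat) (a : V) (r : R[i]) : 0 < r ->
  ~ (exists2 M : R[i], 0 < M & forall i x, `|T i x| <= M * `|x|) ->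
  exists b s, [/\ 0 < s, s < n.+1%:R^-1, `|a - b| + s <= r &
    exists i, forall z, `|b - z| <= s -> n%:R <= `|T i z|].
Proof.
move=> r0 unb; have r20 : 0 < r / 2 by rewrite divr_gt0.
have [i [b [ab Tb]]] : exists i b, `|a - b| <= r / 2 /\ n%:R < `|T i b|.
  apply: contrapT => nex; apply: unb.
  have Tle i b : `|a - b| <= r / 2 -> `|T i b| <= n%:R.
    move=> ab; rewrite real_leNgt ?normr_real ?realn//.
    by apply/negP => Tb; apply: nex; exists i, b.
  exists ((n + n).+1%:R * (r / 2)^-1); first by rewrite mulr_gt0 ?invr_gt0.
  move=> i x; have [->|x0] := eqVneq x 0.
    by rewrite linear0 !normr0 mulr0.
  have nx0 : 0 < `|x| by rewrite normr_gt0.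
  pose c := r / 2 / `|x|; have c0 : 0 < c by rewrite divr_gt0.
  have := Tle i (a + c *: x).
  rewrite opprD addrA subrr sub0r normrN normrZ gtr0_norm// divfK ?gt_eqF//.
  move=> /(_ (lexx _)) le1; have := Tle i a.
  rewrite subrr normr0 => /(_ (ltW r20)) le2.
  have le3 : `|T i (c *: x)| <= n%:R + n%:R.
    rewrite -[c *: x](addKr a) addrC linearB.
    by rewrite (le_trans (ler_normB _ _))// lerD.
  rewrite linearZ normrZ gtr0_norm// in le3.
  rewrite -(ler_pM2l c0) (le_trans le3)//.
  have -> : c * ((n + n).+1%:R * (r / 2)^-1 * `|x|) = (n + n).+1%:R.
    by rewrite /c; field; rewrite !gt_eqF.
  by rewrite -natrD ler_nat.
have [L L0 TL] := continuous_linear_bound (@Tcont i).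
near (0 : R[i])^'+ => s.
exists b, s; split.
- by near: s; exact: nbhs_right_gt.
- by near: s; apply: nbhs_right_lt; rewrite invr_gt0.
- rewrite [leRHS](splitr r) lerD//.
  by near: s; apply: nbhs_right_le.
exists i => z bz.
have : `|T i b| <= `|T i z| + `|T i (b - z)|.
  by rewrite linearB -[X in `|X| <= _](subrKC (T i z)) ler_normD.
rewrite -lerBlDr; apply: le_trans.
rewrite lerBrDl -lerBrDr (le_trans (TL _))//.
rewrite -ler_pdivlMl// (le_trans bz)// mulrC.
by near: s; apply: nbhs_right_le; rewrite divr_gt0// subr_gt0.
Unshelve. all: by end_near. Qed.

(** The Banach-Steinhaus theorem with complex scalars. If it failed, shrinking
    repeatedly would give nested closed balls on the n-th of which some member
    of the family is at least n; completeness gives a point common to all of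
    them, where the family is not bounded. *)
Lemma uniform_boundedness :
  (forall x, exists M, forall i, `|T i x| <= M) ->
  exists2 M : R[i], 0 < M & forall i x, `|T i x| <= M * `|x|.
Proof.
move=> ptw; apply: contrapT => unb.
have step (t : nat * (V * {posnum R[i]})) : exists u : V * {posnum R[i]},
    [/\ u.2%:num < t.1.+1%:R^-1, `|t.2.1 - u.1| + u.2%:num <= t.2.2%:num &
    exists i, forall z, `|u.1 - z| <= u.2%:num -> t.1%:R <= `|T i z|].
  case: t => n [a r] /=.
  have [b [s [s0 sn abs Tbig]]] := unbounded_shrink n a (gt0 r) unb.
  by exists (b, PosNum s0).
have [g Pg] := choice step.
pose fix u n := if n is p.+1 then g (p, u p) else (0 : V, PosNum (@ltr01 R[i])).
pose a n := (u n).1; pose r n := (u n).2%:num.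
have nest n m : (n <= m)%N -> `|a n - a m| + r m <= r n.
  elim: m => [|m IHm].
    by rewrite leqn0 => /eqP ->; rewrite subrr normr0 add0r.
  rewrite leq_eqVlt => /orP[/eqP ->|/IHm]; first by rewrite subrr normr0 add0r.
  apply: le_trans; have [_ le1 _] := Pg (m, u m).
  apply: le_trans (_ : `|a n - a m| + (`|a m - a m.+1| + r m.+1) <= _).
    by rewrite addrA lerD2r ler_distD.
  by rewrite lerD2l.
have r_ge0 n : 0 <= r n by rewrite /r.
have distle n m : (n <= m)%N -> `|a n - a m| <= r n.
  by move=> /nest; apply: le_trans; rewrite lerDl.
have : cvg (a @ \oo).
  apply: cauchy_cvg; apply: cauchy_exP => e e0; rewrite /fmapE -ball_normE.
  have [n ne] := complex_small_inv e0.
  exists (a n.+1), n.+1 => // m nm /=.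
  rewrite (le_lt_trans (distle _ _ nm))//.
  by apply: lt_trans ne; have [] := Pg (n, u n).
move=> /cvg_ex[l al].
have al_le n : `|a n - l| <= r n.
  apply/ler_addgt0Pr => e e0.
  near \oo => m.
  apply: (le_trans (ler_distD (a m) _ _)); rewrite lerD//.
    by apply: distle; near: m; exact: nbhs_infty_ge.
  rewrite distrC; near: m.
  by move/cvgrPdist_le: al; apply.
have [M TM] := ptw l.
have [i0 _] : exists i : I, True.
  by have [_ _ [i _]] := Pg (0%N, u 0%N); exists i.
have MR : M \is Num.real.
  by rewrite ger0_real// (le_trans _ (TM i0)).
have [n Mn] := complex_archimedean MR.
have [_ _ [i Tl]] := Pg (n, u n).
by have := le_lt_trans (le_trans (Tl l (al_le n.+1)) (TM i)) Mn; rewrite ltxx.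
Unshelve. all: by end_near. Qed.

End UniformBoundedness.

(** * Extension from a dense subspace *)

Lemma dense_eq (K : numFieldType) (T : topologicalType) (W : normedModType K)
    (D : set T) (f g : T -> W) :
  dense D -> continuous f -> continuous g -> {in D, f =1 g} -> f =1 g.
Proof.
move=> dD fc gc fg a; apply: contrapT => neq.
pose O := (fun x => f x - g x) @^-1` (~` [set 0]).
have Oo : open O.
  apply: open_comp => [x _|]; first by apply: cvgB; [exact: fc|exact: gc].
  by rewrite openC; apply: accessible_closed_set1; exact: hausdorff_accessible.
have Oa : O !=set0 by exists a; apply/eqP; rewrite subr_eq0; exact/eqP.
have [x [Ox Dx]] := dD _ Oa Oo.
by apply: Ox; rewrite /= fg ?subrr// inE.
Qed.

(** In the complex numbers x <= y means that y - x is equal to its own modulus,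
    so the inequality is an equality between continuous functions. *)
Lemma dense_le (R : realType) (T : topologicalType) (D : set T)
    (f g : T -> R[i]^o) :
  dense D -> continuous f -> continuous g ->
  (forall x, D x -> f x <= g x) -> forall x, f x <= g x.
Proof.
move=> dD fc gc fg x; rewrite -subr_ge0 ger0_def; apply/eqP.
have gfc : continuous (fun x => g x - f x : R[i]^o).
  by move=> y; apply: cvgB; [exact: gc|exact: fc].
have ngfc : continuous (fun x => `|g x - f x| : R[i]^o).
  by move=> y; apply: cvg_norm; exact: gfc.
have eqD : {in D, (fun x => `|g x - f x| : R[i]^o) =1 (fun x => g x - f x)}.
  by move=> y; rewrite inE => Dy; apply/eqP; rewrite -ger0_def subr_ge0 fg.
exact: (dense_eq dD ngfc gfc eqD).
Qed.

Lemma conj_continuous (R : realType) :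
  continuous (Num.conj : R[i]^o -> R[i]^o).
Proof.
move=> z; apply/(@cvgrPdist_lt _ R[i]^o _ (nbhs (z : R[i]^o)) _) => e e0.
apply/(@nbhs_normP R[i] R[i]^o).
by exists e => //= y zy; rewrite -rmorphB norm_conjC.
Qed.

Lemma normc_ge_Im (R : rcfType) (z : R[i]) : `|complex.Im z|%:C%C <= `|z|.
Proof.
rewrite -normrN -ReiNIm (le_trans (normc_ge_Re _))// normrM complexiE normCi.
by rewrite mulr1.
Qed.

Lemma normc_real (R : rcfType) (x : R) : `|x%:C%C| = `|x|%:C%C.
Proof. by rewrite normc_def /= expr0n addr0 sqrtr_sqr. Qed.

Section Extension.
Variables (R : realType) (V H : normedModType R[i]) (i : {linear V -> H}).
Hypothesis i_isometry : forall x, `|i x| = `|x|.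
Hypothesis i_dense : dense (range i).

Let N (W : normedModType R[i]) (x : W) : R := complex.Re `|x|.

Let NE (W : normedModType R[i]) (x : W) : (N x)%:C%C = `|x|.
Proof. by rewrite /N RRe_real ?normr_real. Qed.

(** The construction of McShane's Lipschitz extension at one point a: any value
    between the lower bounds g s - m N (a - i s) and the upper bounds g t + m N
    (a - i t) does, for instance the supremum of the former. *)
Lemma lipschitz_value (g : V -> R) (m : R) (a : H) : 0 <= m ->
  (forall s t, g s - g t <= m * N (i s - i t)) ->
  exists r, forall t, `|r - g t| <= m * N (a - i t).
Proof.
move=> m0 gm.
have sep s t : g s - m * N (a - i s) <= g t + m * N (a - i t).
  have triangle : N (i s - i t) <= N (a - i s) + N (a - i t).
    by rewrite -lecR rmorphD /= !NE (distrC a (i s)) ler_distD.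
  have := gm s t; have := ler_wpM2l m0 triangle; rewrite mulrDr; lra.
pose S := [set g s - m * N (a - i s) | s in [set: V]].
have S0 : S !=set0 by exists (g 0 - m * N (a - i 0)), 0.
exists (sup S) => t; rewrite ler_distl; apply/andP; split.
  apply: sup_upper_bound; last by exists t.
  by split=> //; exists (g 0 + m * N (a - i 0)) => _ [s _ <-]; exact: sep.
by apply: ge_sup => // _ [s _ <-]; exact: sep.
Qed.

Variables (f : {scalar V}) (M : R[i]).
Hypothesis fM : forall x, `|f x| <= M * `|x|.

(** The factor 2 comes from bounding the real and imaginary parts one by one. *)
Lemma bounded_value (a : H) : 0 <= M ->
  exists z : R[i], forall t, `|z - f t| <= 2 * M * `|a - i t|.
Proof.
move=> M0; have MR : (complex.Re M)%:C%C = M by rewrite RRe_real ?ger0_real.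
have m0 : 0 <= complex.Re M by rewrite -ler0c MR.
have distf s t : N (f s - f t : R[i]^o) <= complex.Re M * N (i s - i t).
  by rewrite -lecR rmorphM /= !NE MR -!linearB /= i_isometry fM.
have [|x xP] := @lipschitz_value (fun t => complex.Re (f t)) (complex.Re M) a m0.
  move=> s t; apply: le_trans (distf s t); rewrite /= -raddfB.
  by rewrite (le_trans (ler_norm _))// -lecR NE normc_ge_Re.
have [|y yP] := @lipschitz_value (fun t => complex.Im (f t)) (complex.Re M) a m0.
  move=> s t; apply: le_trans (distf s t); rewrite /= -raddfB.
  by rewrite (le_trans (ler_norm _))// -lecR NE normc_ge_Im.
exists (x +i* y)%C => t.
have -> : (x +i* y)%C - f t =
   (x - complex.Re (f t))%:C%C + 'i%C * (y - complex.Im (f t))%:C%C.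
  by rewrite [LHS]complexE !raddfB.
rewrite (le_trans (ler_normD _ _))// normrM complexiE normCi mul1r.
rewrite !normc_real mulr_natl mulr2n mulrDl -MR -NE.
by rewrite -rmorphM lerD// lecR.
Qed.

(** The values chosen point by point are forced by density to depend linearly on
    the point, since they are approximated by the values of f nearby. *)
Lemma bounded_extension : 0 < M ->
  exists2 w : {scalar H}, (forall t, w (i t) = f t) &
    forall a, `|w a| <= 2 * M * `|a|.
Proof.
move=> M0; have L0 : 0 < 2 * M by rewrite mulr_gt0.
have [w wP] := choice (fun a => bounded_value a (ltW M0)).
have dense_small a (e : R[i]) : 0 < e -> exists t, `|a - i t| < e.
  move=> e0; have [] := i_dense (O := ball a e); first by exists a; exact: ballxx.
    exact: ball_open.
  by move=> x [+ [t _ tx]]; rewrite -tx -ball_normE; exists t.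
have w_lin : linear_for *%R w.
  move=> c a b; apply/eqP; rewrite -subr_eq0 -normr_le0.
  apply/ler_addgt0Pr => e e0; rewrite add0r.
  (* k collects the constants of le1, le2 and le3 below *)
  pose k := 2 * M * (`|c| + 1) *+ 2; have k0 : 0 < k.
    by rewrite pmulrn_lgt0// mulr_gt0// ltr_wpDl.
  have [t at_] := dense_small a (e / k) (divr_gt0 e0 k0).
  have [s bs] := dense_small b (e / k) (divr_gt0 e0 k0).
  have -> : w (c *: a + b) - (c * w a + w b) =
      (w (c *: a + b) - f (c *: t + s)) - (c * (w a - f t) + (w b - f s)).
    by rewrite linearP /=; ring.
  apply: (le_trans (ler_normB _ _)).
  have le1 : `|w (c *: a + b) - f (c *: t + s)| <=
      2 * M * (`|c| * `|a - i t| + `|b - i s|).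
    apply: le_trans (wP _ _) _; rewrite ler_pM2l//.
    rewrite linearP -normrZ (le_trans _ (ler_normD _ _))//.
    by rewrite scalerBr opprD addrACA.
  have le2 : `|c * (w a - f t) + (w b - f s)| <=
      2 * M * (`|c| * `|a - i t| + `|b - i s|).
    rewrite (le_trans (ler_normD _ _))// normrM mulrDr mulrCA.
    by rewrite lerD// ler_wpM2l.
  apply: le_trans (lerD le1 le2) _; rewrite -mulr2n.
  have le3 : `|c| * `|a - i t| + `|b - i s| <= (`|c| + 1) * (e / k).
    by rewrite mulrDl mul1r lerD// ?ler_wpM2l// ltW.
  have -> : e = 2 * M * ((`|c| + 1) * (e / k)) *+ 2.
    rewrite /k; move: (normr_ge0 c); move: `|c| => d d0; field.
    by rewrite !gt_eqF// ltr_wpDl.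
  by rewrite lerMn2r ler_wpM2l// ltW.
pose wl : {scalar H} := HB.pack w (GRing.isLinear.Build _ _ _ _ w w_lin).
exists wl => [t|a] /=.
  apply/eqP; rewrite -subr_eq0 -normr_le0.
  by rewrite (le_trans (wP _ t))// subrr normr0 mulr0.
by have := wP a 0; rewrite (raddf0 i) (raddf0 f) !subr0.
Qed.
End Extension.

(** * Tensor products of bounded functionals *)

Lemma inner_positive_form (R : realType) (V : preHilbertType R) :
  positive_form (fun x y : V => inner x y).
Proof.
split; last by move=> x; exact: dnorm_ge0.
by split=> *; rewrite ?linearPl ?linearPr.
Qed.

Section TensorOfFunctionals.
Variables (R : realType) (U V : preHilbertType R) (T : preHilbertType R).
Variables (t : {bilinear U -> V -> T}).
Hypothesis t_tensor : is_tensor_product t.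
Hypothesis t_inner : forall u v u' v',
  inner (t u v) (t u' v') = inner u u' * inner v v'.

Lemma inner_tensor_sum m n (u : 'I_m -> U) (v : 'I_m -> V)
    (u' : 'I_n -> U) (v' : 'I_n -> V) :
  inner (\sum_i t (u i) (v i)) (\sum_j t (u' j) (v' j)) =
  \sum_i \sum_j inner (u i) (u' j) * inner (v i) (v' j).
Proof.
rewrite linear_sumlz; apply: eq_bigr => i _.
by rewrite linear_sumr; apply: eq_bigr => j _; exact: t_inner.
Qed.

Lemma tensor_functional (f : {scalar U}) (g : {scalar V}) :
  exists h : {scalar T}, forall u v, h (t u v) = f u * g v.
Proof.
pose fg u v : R[i]^o := f u * g v.
have fg_bilinear : bilinear_for (GRing.Scale.Law.clone _ _ *:%R _)
    (GRing.Scale.Law.clone _ _ *:%R _) fg.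
  split=> [v|u] a x y; rewrite /fg linearP.
    by rewrite mulrDl -mulrA.
  by rewrite mulrDr mulrCA.
pose fg' : {bilinear U -> V -> R[i]^o} :=
  HB.pack fg (bilinear_isBilinear.Build _ _ _ _ _ _ fg fg_bilinear).
have [[h ht] _] := t_tensor fg'.
have h_scalar : scalar (h : T -> R[i]) by move=> a x y; rewrite linearP.
pose h' : {scalar T} := HB.pack (h : T -> R[i])
  (GRing.isLinear.Build _ _ _ _ (h : T -> R[i]) h_scalar).
by exists h'.
Qed.

(** A bounded functional as a pairing with the one-dimensional space. *)
Lemma functional_dominated (W : preHilbertType R) (f : {scalar W}) (M : R[i]) :
  0 <= M -> (forall x, `|f x| <= M * `|x|) ->
  dominated (fun (x : W) (c : R[i]^o) => f x * c^*)
    (fun x y => M ^+ 2 * inner x y) (fun c d => c * d^*).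
Proof.
move=> M0 fM; split.
- split=> [a x x' c|a x c c']; first by rewrite linearP /=; ring.
  by rewrite rmorphD rmorphM /= mulrDr mulrCA.
- by apply: positive_formZ; [rewrite exprn_ge0|exact: inner_positive_form].
- split; last by move=> c; exact: mul_conjC_ge0.
  split=> [a c c' d|a c d d']; first by rewrite mulrDl -mulrA.
  by rewrite rmorphD rmorphM /= mulrDr mulrCA.
move=> x c; rewrite -normCK -inner_norm normrM norm_conjC -!exprMn.
by rewrite lerXn2r ?nnegrE ?mulr_ge0// ler_wpM2r.
Qed.

Lemma tensor_functional_bound (f : {scalar U}) (g : {scalar V})
    (h : {scalar T}) (M N : R[i]) : 0 <= M -> 0 <= N ->
  (forall x, `|f x| <= M * `|x|) -> (forall y, `|g y| <= N * `|y|) ->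
  (forall u v, h (t u v) = f u * g v) ->
  forall z, `|h z| <= M * N * `|z|.
Proof.
move=> M0 N0 fM gN ht z.
have [n [u [v ->]]] := tensor_product_sum z t_tensor.
have := tensor_CauchySchwarz u v (fun _ : 'I_1 => 1) (fun=> 1)
  (functional_dominated M0 fM) (functional_dominated N0 gN).
under eq_bigr do rewrite big_ord1 rmorph1 !mulr1 -ht.
rewrite -linear_sum !big_ord1 rmorph1 !mulr1.
under [X in _ <= X -> _]eq_bigr do
  (under eq_bigr do rewrite mulrACA -exprMn; rewrite -mulr_sumr).
rewrite -mulr_sumr -inner_tensor_sum -inner_norm -exprMn.
by rewrite ler_sqr ?nnegrE ?mulr_ge0.
Qed.

End TensorOfFunctionals.

(** * Representable functionals *)

Section HilbertQuasiStarAlgebra.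
Variables (R : realType) (A0 : preHilbertStarAlgType R) (H : hilbertType R).
Variables (Q : hilbert_quasi_star_algebra A0 H) (w : {scalar H}).

Lemma star_isometry (a : A0) : `|star a| = `|a|.
Proof.
apply/eqP; rewrite -(eqrXn2 (n := 2))//; apply/eqP.
by rewrite !inner_norm -(hinner_star Q).
Qed.

Lemma qincl_isometry (a : A0) : `|qincl Q a| = `|a|.
Proof.
apply/eqP; rewrite -(eqrXn2 (n := 2))//; apply/eqP.
by rewrite !inner_norm; case: (hcompletion Q) => ->.
Qed.

(** The inner product of the GNS construction, before its null space is divided
    out. Representability of w is a statement about this form: its positivity,
    its symmetry, and the boundedness of its extension to arguments from H on
    one side. *)
Definition gns_form (x y : A0) : R[i] := w (qincl Q (smul (star y) x)).

Lemma gns_form_sesquilinear : sesquilinear gns_form.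
Proof.
split=> [a x x' y|a x y y']; rewrite /gns_form.
  by rewrite linearPr linearP linearP.
by rewrite linearP linearPl linearP linearP.
Qed.

Section RepresentableContinuous.
Hypothesis w_rep : representable Q w.
Hypothesis w_cont : continuous (w : H -> R[i]^o).

Lemma gns_form_positive : positive_form gns_form.
Proof. by split=> [|x]; [exact: gns_form_sesquilinear|exact: (repL1 w_rep)]. Qed.

Definition right_translate (x : A0) (a : H) : R[i]^o := w (qrmul Q a x).

Lemma right_translate_linear x : linear (right_translate x).
Proof. by move=> c a b; rewrite /right_translate linearPl linearP. Qed.

HB.instance Definition _ x := GRing.isLinear.Build R[i] H R[i]^o *:%R
  (right_translate x) (right_translate_linear x).

Lemma right_translate_continuous x : continuous (right_translate x).
Proof.
move=> a; apply: (@continuous_comp _ _ _ (fun a => qrmul Q a x) w).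
  exact: hrmul_continuous.
exact: w_cont.
Qed.

(** Condition (L.3) bounds the functionals a |-> w (a x), for x in the unit ball
    of the GNS seminorm, at every point a. The uniform boundedness principle
    turns this into a constant that is proportional to the norm of a; the
    completeness of H enters here. *)
Lemma representable_uniform : exists2 M : R[i], 0 < M &
  forall (a : H) (x : A0), `|w (qrmul Q a x)| <= M * `|a| * sqrtC (gns_form x x).
Proof.
have g0 x : 0 <= gns_form x x by have [_] := gns_form_positive.
pose unitball := {x : A0 | gns_form x x <= 1}.
pose T (x : unitball) : {linear H -> R[i]^o} := right_translate (sval x).
have [] := @uniform_boundedness R H R[i]^o unitball T.
- by move=> x; exact: right_translate_continuous.
- move=> a; have [gamma gamma0 le_gamma] := repL3 w_rep (qinv Q a).
  exists gamma => -[x x1]; rewrite /T /right_translate /=.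
  have := le_gamma x; rewrite qinvK => /le_trans; apply.
  rewrite -[leRHS]mulr1 ler_pM2l// -sqrtC1.
  by rewrite ler_sqrtC ?nnegrE//; exact: g0.
move=> M M0 TM; exists M => // a x.
(* such an x cannot be normalized, but (L.3) applies to it directly *)
have [gx|gx] := eqVneq (gns_form x x) 0.
  have [gamma _ /(_ x)] := repL3 w_rep (qinv Q a).
  by rewrite qinvK -/(gns_form x x) gx sqrtC0 !mulr0.
pose r := sqrtC (gns_form x x).
have r0 : 0 < r by rewrite sqrtC_gt0 lt_def gx g0.
have unit_x : gns_form (r^-1 *: x) (r^-1 *: x) <= 1.
  rewrite (sesquilinearZ _ _ _ _ gns_form_positive.1).
  have -> : (r^-1)^* = r^-1 by apply/CrealP; rewrite gtr0_real// invr_gt0.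
  by rewrite -[gns_form x x]sqrtCK -/r -expr2 -exprMn mulVf ?gt_eqF// expr1n.
have := TM (exist (fun y => is_true (gns_form y y <= 1)) _ unit_x) a.
rewrite /T /= /right_translate linearZr_LR /=.
rewrite linearZ normrM gtr0_norm ?invr_gt0// ler_pdivrMl//.
by rewrite mulrC.
Qed.

(** The uniform bound restricted to A0, in the form that passes to tensor
    products. *)
Lemma gns_dominated : exists2 M : R[i], 0 < M &
  dominated gns_form gns_form (fun a b : A0 => M * inner a b).
Proof.
have [M M0 wM] := representable_uniform.
exists (M ^+ 2); first by rewrite exprn_gt0.
split; [by case: gns_form_positive|exact: gns_form_positive|..].
  by apply: positive_formZ; [rewrite exprn_ge0// ltW|exact: inner_positive_form].
move=> x a; rewrite {1}/gns_form -qrmul_incl.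
have le1 := wM (qincl Q (star a)) x; rewrite qincl_isometry star_isometry in le1.
rewrite -inner_norm -exprMn mulrC -[X in _ * X]sqrtCK -exprMn.
by rewrite lerXn2r ?nnegrE//; apply: le_trans le1.
Qed.
End RepresentableContinuous.

(** A converse to gns_dominated. On A0 condition (L.2) is the hermitian symmetry
    of the GNS form, which follows from positivity, and (L.3) is the assumed
    bound; both extend to H because A0 is dense and the operations and w are
    continuous. *)
Lemma representable_of_gns_bound (M : R[i]) :
  continuous (w : H -> R[i]^o) -> (forall x, 0 <= gns_form x x) -> 0 < M ->
  (forall x a, `|gns_form x a| ^+ 2 <= gns_form x x * (M * inner a a)) ->
  representable Q w.
Proof.
move=> w_cont w_pos M_gt0 w_bound.
have pos : positive_form gns_form by split=> //; exact: gns_form_sesquilinear.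
have [_ dense_A0] := hcompletion Q.
have right_cont x : continuous (fun a => qrmul Q (qinv Q a) x).
  move=> a; apply: (@continuous_comp _ _ _ (qinv Q) (fun b => qrmul Q b x)).
    exact: hinv_continuous.
  exact: hrmul_continuous.
have w_right_cont x : continuous (fun a => w (qrmul Q (qinv Q a) x) : R[i]^o).
  move=> a; apply: (@continuous_comp _ _ _ (fun a => qrmul Q (qinv Q a) x) w).
    exact: right_cont.
  exact: w_cont.
have w_left_cont x (g : H -> H) : continuous g ->
    continuous (fun a => w (qlmul Q x (g a)) : R[i]^o).
  move=> gc a; apply: (@continuous_comp _ _ _ (fun a => qlmul Q x (g a)) w).
    by apply: (@continuous_comp _ _ _ g); [exact: gc|exact: hlmul_continuous].
  exact: w_cont.
split=> // [x y|a].
- apply: (@dense_eq R[i] H R[i]^o _ _ _ dense_A0).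
  + by apply: w_left_cont; exact: right_cont.
  + move=> a; apply: (@continuous_comp _ _ _
      (fun a => w (qlmul Q (star x) (qrmul Q a y)) : R[i]^o) Num.conj).
      by apply: w_left_cont; exact: hrmul_continuous.
    exact: conj_continuous.
  move=> _ /set_mem[c _ <-].
  rewrite qinv_incl !qrmul_incl !qlmul_incl smulA -starM.
  exact: (positive_form_herm (smul c y) x pos).
pose k := sqrtC M; have k0 : 0 < k by rewrite sqrtC_gt0.
exists (k * (`|a| + 1)); first by rewrite mulr_gt0// ltr_wpDl.
move=> x; set r := sqrtC _; have r0 : 0 <= r by rewrite sqrtC_ge0; exact: w_pos.
have le1 : `|w (qrmul Q (qinv Q a) x)| <= k * r * `|a|.
  move: a; apply: (@dense_le R H _ _ _ dense_A0).
  - by move=> a; apply: cvg_norm; exact: w_right_cont.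
  - by move=> a; apply: (@cvgMl_tmp R[i]); exact: cvg_norm.
  move=> _ [c _ <-]; rewrite qinv_incl qrmul_incl.
  rewrite -(ler_sqr (x := `|_|)) ?nnegrE ?mulr_ge0 ?(ltW k0)//.
  rewrite qincl_isometry !exprMn !sqrtCK inner_norm.
  by apply: le_trans (w_bound x c) _; rewrite mulrCA mulrA.
by apply: le_trans le1 _; rewrite mulrAC ler_wpM2r// ler_pM2l// lerDl ler01.
Qed.

End HilbertQuasiStarAlgebra.

Theorem proposition4p2 (R : realType)
    (A0 B0 T0 : preHilbertStarAlgType R) (H1 H2 K : hilbertType R)
    (H12 : preHilbertType R)
    (Q1 : hilbert_quasi_star_algebra A0 H1)
    (Q2 : hilbert_quasi_star_algebra B0 H2)
    (Q : hilbert_quasi_star_algebra T0 K)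
    (uQ1 : unital Q1) (uQ2 : unital Q2)
    (tQ : tensor_product_hilbert_quasi_star_algebra H12 Q1 Q2 Q)
    (w1 : {scalar H1}) (w2 : {scalar H2})
    (rw1 : representable Q1 w1) (cw1 : continuous (w1 : H1 -> R[i]^o))
    (rw2 : representable Q2 w2) (cw2 : continuous (w2 : H2 -> R[i]^o)) :
  exists w12 : {scalar H12},
    (forall (n : nat) (xi : 'I_n -> H1) (eta : 'I_n -> H2),
       w12 (\sum_(i < n) tensh tQ (xi i) (eta i)) =
       \sum_(i < n) w1 (xi i) * w2 (eta i)) /\
    exists w : {scalar K},
      [/\ forall t : H12, w (thincl tQ t) = w12 t,
          representable Q w &
          continuous (w : K -> R[i]^o)].
Proof.
have [w12 w12E] := tensor_functional (tenshP tQ) w1 w2.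
exists w12; split.
  by move=> n xi eta; rewrite linear_sum; apply: eq_bigr => i _; exact: w12E.
have [M1 M1_gt0 w1_le] := continuous_functional_bound cw1.
have [M2 M2_gt0 w2_le] := continuous_functional_bound cw2.
have w12_le := tensor_functional_bound (tenshP tQ)
  (@thinner _ _ _ _ _ _ _ _ _ _ _ tQ) (ltW M1_gt0) (ltW M2_gt0)
  w1_le w2_le w12E.
have [thincl_inner thincl_dense] := thcompletion tQ.
have thincl_isometry z : `|thincl tQ z| = `|z|.
  by apply/eqP; rewrite -(eqrXn2 (n := 2))// !inner_norm thincl_inner.
have [w wE w_le] := bounded_extension thincl_isometry thincl_dense w12_le
  (mulr_gt0 M1_gt0 M2_gt0).
have w_cont : continuous (w : K -> R[i]^o).
  by apply: bounded_functional_continuous w_le; rewrite !mulr_ge0 ?ltW.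
exists w; split=> //.
have wT x y : w (qincl Q (tens0 tQ x y)) = w1 (qincl Q1 x) * w2 (qincl Q2 y).
  by rewrite thcompat wE w12E.
have gnsE m n (x : 'I_m -> A0) (y : 'I_m -> B0) (a : 'I_n -> A0) (b : 'I_n -> B0) :
    gns_form Q w (\sum_i tens0 tQ (x i) (y i)) (\sum_j tens0 tQ (a j) (b j)) =
    \sum_i \sum_j gns_form Q1 w1 (x i) (a j) * gns_form Q2 w2 (y i) (b j).
  rewrite /gns_form linear_sumr !linear_sum; apply: eq_bigr => i _.
  rewrite linear_sumlz !linear_sum; apply: eq_bigr => j _.
  by rewrite tens0_star tens0M wT.
have tens0_inner x y x' y' :
    inner (tens0 tQ x y) (tens0 tQ x' y') = inner x x' * inner y y'.
  have [Q_inner _] := hcompletion Q.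
  have [Q1_inner _] := hcompletion Q1; have [Q2_inner _] := hcompletion Q2.
  by rewrite -Q_inner !thcompat thincl_inner thinner Q1_inner Q2_inner.
have [N1 N1_gt0 dom1] := gns_dominated rw1 cw1.
have [N2 N2_gt0 dom2] := gns_dominated rw2 cw2.
have pos1 := gns_form_positive rw1; have pos2 := gns_form_positive rw2.
apply: (representable_of_gns_bound w_cont _ (mulr_gt0 N1_gt0 N2_gt0)) => [x|x a].
  have [n [u [v ->]]] := tensor_product_sum x (tens0P tQ).
  by rewrite gnsE schur_product.
have [m [x1 [x2 ->]]] := tensor_product_sum x (tens0P tQ).
have [n [a1 [a2 ->]]] := tensor_product_sum a (tens0P tQ).
rewrite !gnsE (inner_tensor_sum tens0_inner).
apply: le_trans (tensor_CauchySchwarz x1 x2 a1 a2 dom1 dom2) _.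
rewrite le_eqVlt; apply/orP; left; apply/eqP; congr (_ * _).
rewrite mulr_sumr; apply: eq_bigr => i _.
by rewrite mulr_sumr; apply: eq_bigr => j _; rewrite mulrACA.
Qed.
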